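(* Let $\rho=|\psi\rangle\langle\psi|$ be a pure state of a network of $K$ quantum sensors with local Hermitian generators $\hat h_1,\dots,\hat h_K$, where $\hat h_j$ acts on sensor $j$ only, and let $\mathcal H$ be the $K\times K$ generator matrix of $\rho$, with entries $\mathcal H_{ij}=\langle\psi|\hat h_i\hat h_j|\psi\rangle-\langle\psi|\hat h_i|\psi\rangle\langle\psi|\hat h_j|\psi\rangle$. Let $\Theta=(\vartheta_1,\dots,\vartheta_n)$ be real parameters near $0$, with noise covariance matrix $V=V(\Theta)$, and let $\rho_\vartheta=\Phi_{V}(\rho)$ be the output of a weak-noise channel with covariance $V$ (as defined in the context). Suppose that the quantum Fisher information (QFI) matrix $\mathcal F_{\mathcal Q}(\Theta)$ of the weak-noise problem exists, i.e. there is a real symmetric $n\times n$ matrix $\mathcal F_{\mathcal Q}(\Theta)$ with $$8\left(1-\sqrt{F(\rho,\rho_\vartheta)}\right)=\sum_{I,J=1}^n(\mathcal F_{\mathcal Q}(\Theta))_{IJ}\,\vartheta_I\vartheta_J$$ to leading (second) order in $\Theta$, where $F$ is the fidelity. Then, to leading (second) order in $\Theta$, $$\sum_{I,J=1}^n(\mathcal F_{\mathcal Q}(\Theta))_{IJ}\,\vartheta_I\vartheta_J=4\operatorname{Tr}(V\mathcal H).$$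
   Context: The sensors have Hilbert spaces $\mathscr H$ (possibly infinite-dimensional) and the network has Hilbert space $\mathscr H^{\otimes K}$; the vector $\psi$ is a unit vector lying in the domain of every $\hat h_i$ and every $\hat h_i\hat h_j$. The fidelity of two density operators is $F(\tau,\rho)=\left(\operatorname{Tr}\sqrt{\sqrt\tau\,\rho\,\sqrt\tau}\right)^2$; in particular $F(|\psi\rangle\langle\psi|,\sigma)=\langle\psi|\sigma|\psi\rangle$. The covariance matrix $V(\Theta)$ is a real symmetric positive semidefinite $K\times K$ matrix with $V(\Theta)=O(|\Theta|^2)$ as $\Theta\to0$ (the parameters describe small noise amplitudes about the identity channel). A weak-noise channel with covariance $V$ is one whose output is, as $\Theta\to 0$, $$\Phi_V(\rho)=\rho+\sum_{i,j=1}^K V_{ij}\left(\hat h_i\rho\hat h_j-\tfrac12\{\hat h_i\hat h_j,\rho\}\right)+R_\Theta,$$ where $\{A,B\}=AB+BA$ and the remainder satisfies $\|R_\Theta\|_1=o(|\Theta|^2)$ in trace norm. ''To leading (second) order in $\Theta$'' means up to an error $o(|\Theta|^2)$ as $\Theta\to0$. *)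

(* Defs.v *)
From HB Require Import structures.
From mathcomp Require Import all_boot all_order all_algebra.
From mathcomp Require Import complex.
From mathcomp Require Import summability.
From mathcomp Require Import all_classical all_reals all_analysis.

Set Implicit Arguments.
Unset Strict Implicit.
Unset Printing Implicit Defensive.

Import Order.TTheory GRing.Theory Num.Theory.
Import numFieldNormedType.Exports.

Local Open Scope classical_set_scope.
Local Open Scope complex_scope.
Local Open Scope ring_scope.

(* The library's form [hdot] is linear in its first argument; [braket] swaps
   the arguments, so that ⟨x | y⟩ is antilinear in x and linear in y. *)
Record hilbert (R : realType) := Hilbert {
  hcarrier :> completeNormedModType R[i];
  hdot : {dot hcarrier for (@Num.conj R[i])};
  hdot_norm : forall x : hcarrier, `|x| ^+ 2 = hdot x x }.

Definition braket (R : realType) (E : hilbert R) (x y : E) : R[i] := hdot E y x.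

Notation "⟨ x | y ⟩" := (braket x y)
  (at level 0, x at level 60, y at level 60, format "⟨ x  |  y ⟩")
  : ring_scope.

Definition lin_span (C : pzRingType) (E : lmodType C) (S : set E) : set E :=
  [set v | exists (m : nat) (c : 'I_m -> C) (s : 'I_m -> E),
     (forall k, S (s k)) /\ v = \sum_k c k *: s k].

(* (N, tens) is a Hilbert tensor power of H over K factors, tens x being
   x_0 (x) ... (x) x_(K-1); this determines N up to a unique unitary. *)
Definition is_tensor_power (R : realType) (H N : hilbert R) (K : nat)
    (tens : ('I_K -> H) -> N) : Prop :=
  [/\ forall (x : 'I_K -> H) (j : 'I_K) (a : R[i]) (u v : H),
        tens [eta x with j |-> a *: u + v] =
          a *: tens [eta x with j |-> u] + tens [eta x with j |-> v],
      forall x y : 'I_K -> H, ⟨ tens x | tens y ⟩ = \prod_j ⟨ x j | y j ⟩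
    & closure (lin_span (range tens)) = setT].

(* The values of [op_fun] outside the subspace [op_dom] are irrelevant. *)
Record unbounded_op (R : realType) (E : hilbert R) := UnboundedOp {
  op_dom : set E;
  op_fun :> E -> E;
  op_dom0 : op_dom 0;
  op_domP : forall (a : R[i]) (x y : E),
    op_dom x -> op_dom y -> op_dom (a *: x + y);
  op_linear : forall (a : R[i]) (x y : E), op_dom x -> op_dom y ->
    op_fun (a *: x + y) = a *: op_fun x + op_fun y }.

Section UnboundedOperators.
Variable R : realType.

Definition op_graph (E : hilbert R) (A : unbounded_op E) : set (E * E) :=
  [set p | op_dom A p.1 /\ p.2 = A p.1].

Definition hermitian_op (E : hilbert R) (A : unbounded_op E) : Prop :=
  dense (op_dom A) /\
  forall x y, op_dom A x -> op_dom A y -> ⟨ x | A y ⟩ = ⟨ A x | y ⟩.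

(* The graph of the algebraic operator 1 (x) ... (x) a (x) ... (x) 1, with a in
   the j-th slot. *)
Definition algebraic_local_graph (H N : hilbert R) (K : nat)
    (tens : ('I_K -> H) -> N) (j : 'I_K) (a : unbounded_op H) : set (N * N) :=
  lin_span [set p : N * N | exists x : 'I_K -> H, op_dom a (x j) /\
    p = (tens x, tens [eta x with j |-> a (x j)])].

(* The inclusions cover both the algebraic operator and its closure, the latter
   being the only possibility when A is self-adjoint. *)
Definition acts_on_sensor (H N : hilbert R) (K : nat)
    (tens : ('I_K -> H) -> N) (j : 'I_K) (A : unbounded_op N) : Prop :=
  exists a : unbounded_op H,
    algebraic_local_graph tens j a `<=` op_graph A /\
    op_graph A `<=` closure (algebraic_local_graph tens j a).

End UnboundedOperators.

Section BoundedOperators.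
Variables (R : realType) (E : hilbert R).
Implicit Types (A B S T : E -> E) (x y : E).

Definition bounded_op T : Prop := linear T /\ continuous T.

Definition positive_op T : Prop := forall x, 0 <= ⟨ x | T x ⟩.

Definition ketbra x y : E -> E := fun z => ⟨ y | z ⟩ *: x.

Definition is_adjoint T S : Prop :=
  bounded_op S /\ forall x y, ⟨ S x | y ⟩ = ⟨ x | T y ⟩.

(* Every positive bounded operator has exactly one positive square root. *)
Definition is_sqrt T S : Prop :=
  [/\ bounded_op S, positive_op S & S \o S = T].

Definition orthonormal_basis (I : choiceType) (e : I -> E) : Prop :=
  (forall i j, ⟨ e i | e j ⟩ = (i == j)%:R) /\
  closure (lin_span (range e)) = setT.

(* The sum over the possibly uncountable index set is the limit along the net
   of finite partial sums. *)
Definition has_trace T (t : R[i]) : Prop :=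
  forall (I : choiceType) (e : I -> E), orthonormal_basis e ->
    partial_sum (fun i => ⟨ e i | T (e i) ⟩) @ totally --> (t : R[i]^o).

(* t is the trace of |T|, the square root of T^* T. *)
Definition has_trace_norm T (t : R) : Prop :=
  exists S A, [/\ is_adjoint T S, is_sqrt (S \o T) A & has_trace A t%:C].

Definition trace_class T : Prop :=
  bounded_op T /\ exists t, has_trace_norm T t.

Definition trace_norm T : R := xget 0 [set t | has_trace_norm T t].

(* S is the square root of tau and M that of (sqrt tau) sigma (sqrt tau). *)
Definition fidelity (tau sigma : E -> E) : R :=
  xget 0 [set f | exists S M t,
    [/\ is_sqrt tau S, is_sqrt (S \o sigma \o S) M, has_trace M t%:C
      & f = t ^+ 2]].

(* Positivity of the operator matrix (T i j) on the m-fold direct sum of E. *)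
Definition positive_block (m : nat) (T : 'I_m -> 'I_m -> E -> E) : Prop :=
  forall x : 'I_m -> E, 0 <= \sum_i \sum_j ⟨ x i | T i j (x j) ⟩.

(* Quantum channels in the Schroedinger picture: completely positive
   trace-preserving maps on the trace-class operators. *)
Definition is_channel (Phi : (E -> E) -> E -> E) : Prop :=
  [/\ forall T, trace_class T -> trace_class (Phi T),
      forall (a : R[i]) T S, trace_class T -> trace_class S ->
        Phi (a *: T + S) = a *: Phi T + Phi S,
      forall (m : nat) (T : 'I_m -> 'I_m -> E -> E),
        (forall i j, trace_class (T i j)) -> positive_block T ->
        positive_block (fun i j => Phi (T i j))
    & forall T t, trace_class T -> has_trace T t -> has_trace (Phi T) t].

End BoundedOperators.

Section WeakNoise.
Variables (R : realType) (n K : nat).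
Local Notation origin := (0 : 'rV[R]_n).

Definition covariance_family (V : 'rV[R]_n -> 'M[R]_K) : Prop :=
  (\forall Th \near origin,
      (V Th)^T = V Th /\
      forall x : 'cV[R]_K, 0 <= (x^T *m V Th *m x) 0 0) /\
  V =O_origin (fun Th => `|Th| ^+ 2 : R^o).

Variable N : hilbert R.

(* h_i rho h_j - {h_i h_j, rho} / 2 for rho = |psi><psi|: the h's being
   Hermitian, h_i rho h_j = |h_i psi><h_j psi| and
   rho h_i h_j = |psi><h_j h_i psi|. *)
Definition noise_term (h : 'I_K -> unbounded_op N) (psi : N) (i j : 'I_K) :
    N -> N :=
  ketbra (h i psi) (h j psi)
  - 2^-1 *: (ketbra (h i (h j psi)) psi + ketbra psi (h j (h i psi))).

(* Phi Th is the channel at parameter Th; only its output on |psi><psi| is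
   expanded. *)
Definition weak_noise_channel (h : 'I_K -> unbounded_op N) (psi : N)
    (V : 'rV[R]_n -> 'M[R]_K) (Phi : 'rV[R]_n -> (N -> N) -> N -> N) : Prop :=
  (\forall Th \near origin, is_channel (Phi Th)) /\
  exists Rem : 'rV[R]_n -> N -> N,
    [/\ \forall Th \near origin,
          Phi Th (ketbra psi psi) = ketbra psi psi
            + \sum_i \sum_j (V Th i j)%:C *: noise_term h psi i j + Rem Th,
        \forall Th \near origin, trace_class (Rem Th)
      & (fun Th => trace_norm (Rem Th) : R^o)
          =o_origin (fun Th => `|Th| ^+ 2 : R^o)].

Definition generator_matrix (h : 'I_K -> unbounded_op N) (psi : N) :
    'M[R[i]]_K :=
  \matrix_(i, j)
    (⟨ psi | h i (h j psi) ⟩ - ⟨ psi | h i psi ⟩ * ⟨ psi | h j psi ⟩).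

Definition quad_form (F : 'M[R]_n) (Th : 'rV[R]_n) : R :=
  \sum_I \sum_J F I J * Th 0 I * Th 0 J.

(* Equality to second order as Theta -> 0; |Theta| is the sup norm, which is
   equivalent to the Euclidean one. *)
Definition eq_second_order (f g : 'rV[R]_n -> R[i]) : Prop :=
  (fun Th => f Th - g Th : R[i]^o)
    =o_origin (fun Th => (`|Th| ^+ 2)%:C : R[i]^o).

Definition is_qfi_matrix (rho : N -> N) (rho_out : 'rV[R]_n -> N -> N)
    (F : 'rV[R]_n -> 'M[R]_n) : Prop :=
  (\forall Th \near origin, (F Th)^T = F Th) /\
  eq_second_order
    (fun Th => (8 * (1 - Num.sqrt (fidelity rho (rho_out Th))))%:C)
    (fun Th => (quad_form (F Th) Th)%:C).

End WeakNoise.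

(* Main.v *)
From HB Require Import structures.
Require Import Defs.
From mathcomp Require Import all_boot all_order all_algebra.
From mathcomp Require Import finmap complex ring lra.
From mathcomp Require Import summability.
From mathcomp Require Import all_classical all_reals all_analysis.

(* Put rho = |psi><psi|. Its square root and that of rho sigma rho = s rho,
   where s = <psi|sigma|psi>, are unique and multiples of rho, so the fidelity
   of rho and sigma is s. For sigma the output of the channel, <psi| . |psi>
   maps the noise terms to - V_ij H_ij and the remainder to something of modulus
   at most its trace norm, so s = 1 - w with w = Tr(V H) + o(|Theta|^2), and
   8 (1 - sqrt (1 - w)) = 4 w + O(w^2).

   A trace being defined through all orthonormal bases, it is single-valued only
   because a basis exists. One exists through any given unit vector (by Zorn's
   lemma and orthogonal projection); this also yields the trace norm bound. *)

Set Implicit Arguments.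
Unset Strict Implicit.
Unset Printing Implicit Defensive.

Import Order.TTheory GRing.Theory Num.Theory.
Import numFieldNormedType.Exports.

Local Open Scope classical_set_scope.
Local Open Scope complex_scope.
Local Open Scope ring_scope.

(** Evaluate at the minimizer [t = 1 / c]; if [c = 0] the expression is affine in [t], which forces
    [b = 0]. With [b] a squared modulus, occurring in both coefficients, this is the core of the
    Cauchy-Schwarz inequality. *)
Lemma discriminant_le (C : numFieldType) (a b c : C) : 0 <= b -> 0 <= c ->
  (forall t, 0 <= t -> 0 <= a - 2 * t * b + t ^+ 2 * b * c) -> b <= a * c.
Proof.
move=> b0 c0 H.
have a0 : 0 <= a.
  by have := H 0 (lexx _); rewrite expr0n /= !(mulr0, mul0r) subr0 addr0.
have [->|bn0] := eqVneq b 0; first exact: mulr_ge0.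
have bp : 0 < b by rewrite lt_def bn0.
have [c_eq0|cn0] := eqVneq c 0.
  have t0 : 0 <= (a + 1) / (2 * b).
    by rewrite divr_ge0 ?addr_ge0 ?mulr_ge0 ?ler01 ?ler0n.
  have := H _ t0; rewrite c_eq0 mulr0 addr0.
  have -> : a - 2 * ((a + 1) / (2 * b)) * b = -1.
    by field; rewrite bn0.
  by rewrite oppr_ge0 lt_geF ?ltr01.
have t0 : 0 <= c^-1 by rewrite invr_ge0.
have := H _ t0.
have -> : a - 2 * c^-1 * b + c^-1 ^+ 2 * b * c = a - b / c.
  by field.
by rewrite subr_ge0 ler_pdivrMr // lt_def cn0.
Qed.

Lemma ge0_RRe (R : rcfType) (z : R[i]) : 0 <= z -> (complex.Re z)%:C = z.
Proof. by move=> z0; rewrite RRe_real ?ger0_real. Qed.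

Lemma normc_real (R : rcfType) (x : R) : `|x%:C| = `|x|%:C.
Proof. by rewrite normc_def /= expr0n addr0 sqrtr_sqr. Qed.

(** * The inner product *)

Section Braket.
Variables (R : realType) (E : hilbert R).
Implicit Types (x y z : E) (a : R[i]) (A S T : E -> E).

Lemma braketDr x y z : ⟨ x | y + z ⟩ = ⟨ x | y ⟩ + ⟨ x | z ⟩.
Proof. exact: linearDl. Qed.

Lemma braketDl x y z : ⟨ x + y | z ⟩ = ⟨ x | z ⟩ + ⟨ y | z ⟩.
Proof. exact: linearDr. Qed.

Lemma braketZr a x y : ⟨ x | a *: y ⟩ = a * ⟨ x | y ⟩.
Proof. exact: linearZl_LR. Qed.

Lemma braketZl a x y : ⟨ a *: x | y ⟩ = a^* * ⟨ x | y ⟩.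
Proof. exact: linearZr_LR. Qed.

Lemma braketBr x y z : ⟨ x | y - z ⟩ = ⟨ x | y ⟩ - ⟨ x | z ⟩.
Proof. exact: linearBl. Qed.

Lemma braketBl x y z : ⟨ x - y | z ⟩ = ⟨ x | z ⟩ - ⟨ y | z ⟩.
Proof. exact: linearBr. Qed.

Lemma braket0r x : ⟨ x | 0 ⟩ = 0.
Proof. exact: linear0l. Qed.

Lemma braket0l x : ⟨ 0 | x ⟩ = 0.
Proof. exact: linear0r. Qed.

Lemma braket_sumr I (r : seq I) (P : pred I) (F : I -> E) x :
  ⟨ x | \sum_(i <- r | P i) F i ⟩ = \sum_(i <- r | P i) ⟨ x | F i ⟩.
Proof. exact: (big_morph _ (braketDr x) (braket0r x)). Qed.

Lemma braket_suml I (r : seq I) (P : pred I) (F : I -> E) x :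
  ⟨ \sum_(i <- r | P i) F i | x ⟩ = \sum_(i <- r | P i) ⟨ F i | x ⟩.
Proof.
exact: (big_morph (fun y => ⟨ y | x ⟩)
  (fun y z => braketDl y z x) (braket0l x)).
Qed.

Lemma braketC x y : ⟨ x | y ⟩^* = ⟨ y | x ⟩.
Proof. by rewrite /braket [RHS](hermC (hdot E)) /= expr0 mul1r. Qed.

Lemma braket_normE x : ⟨ x | x ⟩ = `|x| ^+ 2.
Proof. by rewrite hdot_norm. Qed.

Lemma braket_ge0 x : 0 <= ⟨ x | x ⟩.
Proof. by rewrite braket_normE exprn_ge0. Qed.

Lemma braket_eq0 x : ⟨ x | x ⟩ = 0 -> x = 0.
Proof.
by rewrite braket_normE => /eqP; rewrite sqrf_eq0 normr_eq0 => /eqP.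
Qed.

Lemma braket_orthC x y : ⟨ x | y ⟩ = 0 -> ⟨ y | x ⟩ = 0.
Proof. by move=> xy; rewrite -braketC xy rmorph0. Qed.

Lemma linear_opD T : linear T -> {morph T : x y / x + y}.
Proof. by move=> Tl x y; have := Tl 1 x y; rewrite !scale1r. Qed.

Lemma linear_op0 T : linear T -> T 0 = 0.
Proof.
by move=> Tl; have := linear_opD Tl 0 0; rewrite addr0 -[LHS]addr0 => /addrI.
Qed.

Lemma linear_opZ T : linear T -> forall a, {morph T : x / a *: x}.
Proof. by move=> Tl a x; have := Tl a x 0; rewrite (linear_op0 Tl) !addr0. Qed.

(** The direction [b^* *: y] makes the two cross terms equal and real, which gives the form the
    shape that [discriminant_le] treats. *)
Lemma braket_quadratic T x y (t : R[i]) (b := ⟨ x | T y ⟩) :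
  linear T -> (forall z w, ⟨ z | T w ⟩ = ⟨ T z | w ⟩) -> t \is Num.real ->
  let z := x - t * b^* *: y in
  ⟨ z | T z ⟩ = ⟨ x | T x ⟩ - 2 * t * `|b| ^+ 2
                  + t ^+ 2 * `|b| ^+ 2 * ⟨ y | T y ⟩.
Proof.
move=> Tl Th tr /=.
have Tyx : ⟨ y | T x ⟩ = b^* by rewrite Th braketC.
rewrite -scaleNr (linear_opD Tl) (linear_opZ Tl).
rewrite !braketDl !braketDr !braketZl !braketZr Tyx -/b.
rewrite rmorphN rmorphM /= conjCK (CrealP tr) normCK.
by ring.
Qed.

(* The diagonal values of x |-> ⟨ x | A x ⟩ being real, polarization applied to
   x + y and x + 'i y shows that A is symmetric. *)
Lemma positive_op_sym A : linear A -> positive_op A ->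
  forall x y, ⟨ x | A y ⟩ = ⟨ A x | y ⟩.
Proof.
move=> Al A0 x y.
have realA z : ⟨ z | A z ⟩^* = ⟨ z | A z ⟩.
  by apply/CrealP; rewrite ger0_real // A0.
have H1 := realA (x + y); have H2 := realA (x + 'i *: y).
move: H1 H2; rewrite !(linear_opD Al) !(linear_opZ Al).
rewrite !braketDl !braketDr !braketZl !braketZr.
rewrite !rmorphD !rmorphM /= !realA conjCi rmorphN /= conjCi opprK.
rewrite -[⟨ A x | y ⟩]braketC.
set p := ⟨ x | A y ⟩; set q := ⟨ y | A x ⟩.
set a := ⟨ x | A x ⟩; set d := ⟨ y | A y ⟩.
move=> H1 H2.
have {}H1 : p^* + q^* = p + q.
  have -> : p^* + q^* = a + p^* + (q^* + d) - a - d by ring.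
  by rewrite H1; ring.
have {}H2 : q^* - p^* = p - q.
  have i0 : 'i != 0 :> R[i] by exact: neq0Ci.
  apply: (mulfI i0).
  have -> : 'i * (q^* - p^*) =
      a + - 'i * p^* + ('i * q^* + 'i * (- 'i * d)) - a + 'i * 'i * d by ring.
  by rewrite H2; ring.
have : 2 * p = 2 * q^*.
  have -> : 2 * p = (p + q) + (p - q) by ring.
  by rewrite -H1 -H2; ring.
by apply: mulfI; rewrite pnatr_eq0.
Qed.

Lemma positive_op_cauchy_schwarz A x y : linear A -> positive_op A ->
  `|⟨ x | A y ⟩| ^+ 2 <= ⟨ x | A x ⟩ * ⟨ y | A y ⟩.
Proof.
move=> Al A0; apply: discriminant_le; rewrite ?exprn_ge0 ?A0 // => t t0.
have <- := braket_quadratic x y Al (positive_op_sym Al A0) (ger0_real t0).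
exact: A0.
Qed.

Lemma braket_cauchy_schwarz x y : `|⟨ x | y ⟩| <= `|x| * `|y|.
Proof.
rewrite -(@ler_pXn2r _ 2) // ?nnegrE ?mulr_ge0 // exprMn -!braket_normE.
exact: (@positive_op_cauchy_schwarz id x y (fun _ _ _ => erefl) braket_ge0).
Qed.

End Braket.

(** * Orthogonal projection *)

Section Projection.
Variables (R : realType) (E : hilbert R).
Implicit Types (x y m : E) (L S : set E).

Definition subspace L : Prop :=
  L 0 /\ forall (a : R[i]) x y, L x -> L y -> L (a *: x + y).

Lemma subspaceB L x y : subspace L -> L x -> L y -> L (x - y).
Proof. by move=> [_ Ls] Lx Ly; rewrite addrC -scaleN1r; exact: Ls. Qed.

Lemma lin_span_subspace S : subspace (lin_span S).
Proof.
split=> [|a _ _ [m [c [s [Ss ->]]]] [n [c' [s' [Ss' ->]]]]].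
  by exists 0%N, (fun=> 0), (fun=> 0); split=> [[]|]; rewrite ?big_ord0.
pose glue T (f : 'I_m -> T) (g : 'I_n -> T) (k : 'I_(m + n)) :=
  match fintype.split k with inl i => f i | inr j => g j end.
exists (m + n)%N, (glue _ (fun i => a * c i) c'), (glue _ s s'); split=> [k|].
  by rewrite /glue; case: (fintype.split k).
rewrite big_split_ord /= scaler_sumr; congr (_ + _); apply: eq_bigr => i _.
  by rewrite /glue (unsplitK (inl i)) scalerA.
by rewrite /glue (unsplitK (inr i)).
Qed.

Lemma lin_span_sub S : S `<=` lin_span S.
Proof.
move=> s Ss; exists 1%N, (fun=> 1), (fun=> s); split=> //.
by rewrite big_ord1 scale1r.
Qed.

(** Quantitative form of the fact that a nearest point has an orthogonal residual: moving [y] along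
    [m] stays in [L], hence at squared distance at least [d], so [discriminant_le] applies with
    [a = e ^+ 2]. *)
Lemma approx_minimizer_orth L x y m (d e : R[i]) : subspace L -> L y -> L m ->
  (forall z, L z -> d <= `|x - z| ^+ 2) -> 0 <= e ->
  `|x - y| ^+ 2 <= d + e ^+ 2 -> `|⟨ x - y | m ⟩| <= e * `|m|.
Proof.
move=> [_ Ls] Ly Lm dmin e0 yd.
rewrite -(@ler_pXn2r _ 2) // ?nnegrE ?mulr_ge0 // exprMn.
apply: discriminant_le; rewrite ?exprn_ge0 // => t t0.
have := braket_quadratic (T := id) (x - y) m (fun _ _ _ => erefl)
  (fun _ _ => erefl) (ger0_real t0).
rewrite /= !braket_normE; set b := ⟨ x - y | m ⟩ => quad.
have : d <= `|x - y - t * b^* *: m| ^+ 2.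
  by rewrite -addrA -opprD [y + _]addrC; apply: dmin; exact: Ls.
rewrite quad -subr_ge0 => /le_trans; apply.
rewrite -subr_ge0; move: yd; rewrite -subr_ge0; congr (0 <= _).
by ring.
Qed.

Lemma le_small_mul_eq0 (z C : R[i]) : 0 <= C ->
  (forall e : R, 0 < e -> `|z| <= e%:C * C) -> z = 0.
Proof.
move=> C0 H; apply/eqP; apply/negPn/negP => z0.
have z0' : 0 < `|z| by rewrite normr_gt0.
have C1 : 0 < C + 1 by rewrite ltr_wpDl.
have q0 : 0 < `|z| / (C + 1) by rewrite divr_gt0.
have := H (complex.Re (`|z| / (C + 1))).
rewrite -ltcR (ge0_RRe (ltW q0)) => /(_ q0).
rewrite mulrAC ler_pdivlMr // ler_pM2l //.
by rewrite gerDl ler10.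
Qed.

(** The sets [A e] of approximate minimizers of the distance to [x] generate a filter. It is Cauchy
    by [approx_minimizer_orth], so it converges in the complete space [E], and the orthogonality
    bounds pass to its limit [p]. *)
Lemma orthogonal_projection L x : subspace L ->
  exists2 p, closure L p & forall m, L m -> ⟨ x - p | m ⟩ = 0.
Proof.
move=> Lsub; have [L0 Ls] := Lsub.
pose D : set R := [set complex.Re (`|x - y| ^+ 2) | y in L].
have DE y : (complex.Re (`|x - y| ^+ 2))%:C = `|x - y| ^+ 2.
  by rewrite ge0_RRe ?exprn_ge0.
have Dinf : has_inf D.
  split; first by exists (complex.Re (`|x - 0| ^+ 2)), 0.
  by exists 0 => _ [y _ <-]; rewrite -lecR DE exprn_ge0.
pose d := (inf D)%:C.
have dmin z : L z -> d <= `|x - z| ^+ 2.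
  by move=> Lz; rewrite -DE lecR; apply: ge_inf; [case: Dinf|exists z].
pose A (e : R) := [set y | L y /\ `|x - y| ^+ 2 <= d + e%:C ^+ 2].
pose F := filter_from [set e : R | 0 < e] A.
have AF e : 0 < e -> F (A e) by move=> e0; exists e.
have FF : ProperFilter F.
  apply: filter_from_proper => [|e /= e0].
    apply: filter_from_filter; first by exists 1 => /=.
    move=> e e' /= e0 e0'; have m0 : 0 < Num.min e e' by rewrite lt_min e0.
    exists (Num.min e e') => // y [Ly yd].
    split; split=> //; apply: (le_trans yd); rewrite lerD2l -!rmorphXn lecR;
      by apply: lerXn2r; rewrite ?nnegrE ?(ltW m0) ?(ltW e0) ?(ltW e0') //
        ge_min lexx ?orbT.
  have [|_ [y Ly <-] yd] := @inf_adherent _ D (e ^+ 2) _ Dinf.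
    by rewrite exprn_gt0.
  by exists y; split=> //; rewrite -DE -rmorphXn -rmorphD lecR ltW.
have Aorth e y m : 0 < e -> A e y -> L m -> `|⟨ x - y | m ⟩| <= e%:C * `|m|.
  move=> e0 [Ly yd] Lm; apply: (approx_minimizer_orth Lsub Ly Lm dmin _ yd).
  by rewrite lecR ltW.
have Fc : cauchy F.
  apply/cauchy_exP => eps eps0.
  (* Two elements of [A e] are at most [2 * e] apart; dividing by 3 makes the final bound strict. *)
  pose e := complex.Re eps / 3.
  have epsE : (e *+ 3)%:C = eps.
    by rewrite /e -mulr_natr divfK ?pnatr_eq0 // ge0_RRe ?ltW.
  have e0 : 0 < e by rewrite -(pmulrn_lgt0 _ (isT : (0 < 3)%N)) -ltcR epsE.
  have [y Ay] := filter_ex (AF _ e0); exists y; exists e => // y' Ay' /=.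
  rewrite -ball_normE /= -epsE.
  have [->|yy'] := eqVneq y y'.
    by rewrite subrr normr0 ltcR mulrn_wgt0.
  have Lyy' : L (y - y') by apply: subspaceB => //; [case: Ay|case: Ay'].
  have : `|y - y'| ^+ 2 <= (e *+ 2)%:C * `|y - y'|.
    (* Splitting one factor of the squared norm in this way leaves two pairings with a vector of
       [L], each at most [e] times its norm. *)
    have yE : y - y' = (x - y') - (x - y).
      by rewrite opprB [RHS]addrC addrA subrK.
    have -> : `|y - y'| ^+ 2 = `|⟨ x - y' | y - y' ⟩ - ⟨ x - y | y - y' ⟩|.
      by rewrite -braketBl -yE braket_normE normrX normr_id.
    rewrite mulr2n rmorphD mulrDl (le_trans (ler_normB _ _)) //.
    by rewrite lerD // Aorth.
  rewrite expr2 ler_pM2r ?normr_gt0 ?subr_eq0 // => /le_lt_trans; apply.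
  by rewrite ltcR ltr_pMn2l.
have Fp : F --> lim F := cauchy_cvg _ Fc.
move: (lim F) Fp => p Fp.
exists p.
  move=> B /Fp FB; apply: (@filter_ex _ F); apply: filterI => //.
  by apply: filterS (AF 1 ltr01) => y [].
move=> m Lm; apply: (@le_small_mul_eq0 _ (2 * `|m|)) => [|e e0].
  by rewrite mulr_ge0.
have [y [Ay py]] : exists y, A e y /\ `|p - y| < e%:C.
  have Fpe : F (ball p e%:C) by apply: Fp; apply: nbhsx_ballx; rewrite ltcR.
  have [y [Ay py]] := filter_ex (filterI (AF _ e0) Fpe).
  by exists y; split=> //; move: py; rewrite -ball_normE.
have -> : x - p = (x - y) - (p - y) by rewrite opprB addrA subrK.
rewrite braketBl (le_trans (ler_normB _ _)) // mulrCA mulr_natl mulr2n.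
rewrite lerD ?Aorth // (le_trans (braket_cauchy_schwarz _ _)) //.
by rewrite ler_wpM2r // ltW.
Qed.

End Projection.

#[local] Existing Instance totally_filter.

(** * Orthonormal bases *)

Section OrthonormalBasis.
Variables (R : realType) (E : hilbert R).

Definition orthonormal_set (S : set E) : Prop :=
  forall x y, S x -> S y -> ⟨ x | y ⟩ = (x == y)%:R.

Lemma normalized_unit (v : E) : v != 0 ->
  ⟨ `|v|^-1 *: v | `|v|^-1 *: v ⟩ = 1.
Proof.
move=> v0; rewrite braketZl braketZr braket_normE geC0_conj ?invr_ge0 //.
by field; rewrite normr_eq0.
Qed.

(** Zorn's lemma is applied to the sets that are orthonormal once [phi] is adjoined; this keeps
    [phi] in the result and covers the empty chain. A nonzero vector orthogonal to a maximal set
    could be normalized and added. *)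
Lemma exists_maximal_orthonormal_set (phi : E) : ⟨ phi | phi ⟩ = 1 ->
  exists2 S : set E, S phi & orthonormal_set S /\
    forall v, (forall s, S s -> ⟨ s | v ⟩ = 0) -> v = 0.
Proof.
move=> phi1.
have [|A [PA Amax]] :=
    @Zorn_bigcup _ [set A | orthonormal_set (A `|` [set phi])].
  move=> C PC Ctot x y [[X CX Xx]|->] [[Y CY Yy]|->].
  - have [XY|YX] := Ctot X Y CX CY.
      by apply: (PC _ CY); left => //; exact: XY.
    by apply: (PC _ CX); left => //; exact: YX.
  - by apply: (PC _ CX); [left|right].
  - by apply: (PC _ CY); [right|left].
  - by rewrite phi1 eqxx.
exists (A `|` [set phi]); first by right.
split=> // v Av; apply/eqP/negPn/negP => v0.
pose w := `|v|^-1 *: v.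
have w1 : ⟨ w | w ⟩ = 1 by exact: normalized_unit.
have Aw s : (A `|` [set phi]) s -> ⟨ s | w ⟩ = 0.
  by move=> /Av sv; rewrite braketZr sv mulr0.
have wA s : (A `|` [set phi]) s -> (s == w) = false.
  move=> /Aw sw; apply/eqP => swE; move: sw; rewrite swE w1 => /eqP.
  by rewrite oner_eq0.
apply: (Amax (A `|` [set w])).
  split; first by move=> x Ax; left.
  move=> /(_ w (or_intror erefl)) => Aw'.
  by have := wA w (or_introl Aw'); rewrite eqxx.
suff onw x y : ((A `|` [set phi]) `|` [set w]) x ->
    ((A `|` [set phi]) `|` [set w]) y -> ⟨ x | y ⟩ = (x == y)%:R.
  by move=> x y; rewrite setUAC; exact: onw.
move=> [Ax|->] [Ay|->].
- exact: PA.
- by rewrite wA // Aw.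
- by rewrite eq_sym wA // braket_orthC // Aw.
- by rewrite eqxx w1.
Qed.

(** The span of a maximal set is dense: the residual of any [x] after projection onto the closed
    span is orthogonal to the set, hence zero. *)
Lemma orthonormal_basis_extension (phi : E) : ⟨ phi | phi ⟩ = 1 ->
  exists (I : choiceType) (e : I -> E) (i : I),
    orthonormal_basis e /\ e i = phi.
Proof.
move=> /exists_maximal_orthonormal_set[S Sphi [Son Smax]].
exists S, (fun i => \val i), (SigSub (mem_set Sphi)); split=> //; split.
  by move=> i j; rewrite Son ?val_eqE //; exact: set_valP.
have rS : range (fun i : S => \val i) = S.
  apply/seteqP; split=> [_ [i _ <-]|x Sx]; first exact: set_valP.
  by exists (SigSub (mem_set Sx)).
rewrite rS; apply/seteqP; split=> // x _.
have [p Cp xp] := orthogonal_projection x (lin_span_subspace S).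
suff /subr0_eq -> : x - p = 0 by [].
by apply: Smax => s Ss; apply: braket_orthC; apply: xp; exact: lin_span_sub.
Qed.

(** * Finite partial expansions and Parseval's identity *)

Section Parseval.
Variables (I : choiceType) (e : I -> E).
Hypothesis e_on : forall i j, ⟨ e i | e j ⟩ = (i == j)%:R.

Definition partial_expansion (J : {fset I}) (x : E) : E :=
  \sum_(i <- J) ⟨ e i | x ⟩ *: e i.

Lemma partial_expansion_orth (J : {fset I}) x j : j \in J ->
  ⟨ e j | x - partial_expansion J x ⟩ = 0.
Proof.
move=> jJ; rewrite braketBr braket_sumr (bigD1_seq j) ?fset_uniq //=.
rewrite big1 => [|i ij]; last by rewrite braketZr e_on eq_sym (negbTE ij) mulr0.
by rewrite braketZr e_on eqxx mulr1 addr0 subrr.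
Qed.

(** Bessel's identity: the residual is orthogonal to the partial expansion, so its squared norm is
    its pairing with [x]. *)
Lemma partial_expansion_normB (J : {fset I}) x :
  `|x - partial_expansion J x| ^+ 2 =
    `|x| ^+ 2 - partial_sum (fun i => `|⟨ e i | x ⟩| ^+ 2) J.
Proof.
rewrite -!braket_normE braketBl {2}/partial_expansion braket_suml.
rewrite big_seq [X in _ - X]big1 ?subr0 => [|i iJ]; last first.
  by rewrite braketZl partial_expansion_orth ?mulr0.
rewrite braketBr braket_sumr /partial_sum -(big_seq_fsetE _ J xpredT
  (fun i => `|⟨ e i | x ⟩| ^+ 2)) /=.
by congr (_ - _); apply: eq_bigr => i _; rewrite braketZr normCK braketC.
Qed.

(** The hypothesis says by duality that [v] lies in the span of the [e i] with [i] in [J]. The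
    squared norm of the residual [r] is then ⟨x - v | r⟩, and Cauchy-Schwarz concludes. *)
Lemma partial_expansion_best (J : {fset I}) x v :
  (forall y, (forall i, i \in J -> ⟨ e i | y ⟩ = 0) -> ⟨ v | y ⟩ = 0) ->
  `|x - partial_expansion J x| <= `|x - v|.
Proof.
move=> vJ; set r := x - _.
have er i : i \in J -> ⟨ e i | r ⟩ = 0 by exact: partial_expansion_orth.
have pr : ⟨ partial_expansion J x | r ⟩ = 0.
  rewrite braket_suml big_seq big1 // => i iJ.
  by rewrite braketZl er ?mulr0.
have rr : `|r| ^+ 2 = `|⟨ x - v | r ⟩|.
  rewrite braketBl (vJ r er) subr0.
  rewrite -[x in ⟨ x | r ⟩](subrK (partial_expansion J x)).
  by rewrite braketDl pr addr0 braket_normE normrX normr_id.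
have [->|r0] := eqVneq r 0; first by rewrite normr0.
have := braket_cauchy_schwarz (x - v) r.
by rewrite -rr expr2 ler_pM2r // normr_gt0.
Qed.

(** Density supplies a finite combination [v] close to [x]. For every [J] containing its indices the
    partial expansion is at least as close, and Bessel's identity turns squared distance into the
    defect of the partial sum. *)
Lemma parseval x : closure (lin_span (range e)) = setT ->
  partial_sum (fun i => `|⟨ e i | x ⟩| ^+ 2) @ totally -->
    (`|x| ^+ 2 : R[i]^o).
Proof.
move=> e_full; apply/(@cvgrPdist_le _ R[i]^o) => eps eps0.
have s0 : 0 < sqrtC eps by rewrite sqrtC_gt0.
have : closure (lin_span (range e)) x by rewrite e_full.
move=> /(_ _ (nbhsx_ballx x _ s0)) [_ [[m [c [s [es ->]]]]]].
set v := \sum_k _; rewrite -ball_normE /= => xv.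
have /choice[i si] : forall k, exists i, e i = s k.
  by move=> k; have [i _ <-] := es k; exists i.
exists [fset i k | k in 'I_m]%fset => // J /= iJ.
rewrite -partial_expansion_normB normrX normr_id -[leRHS]sqrtCK.
rewrite lerXn2r ?nnegrE ?(ltW s0) // (le_trans _ (ltW xv)) //.
apply: partial_expansion_best => y Jy; rewrite braket_suml big1 // => k _.
rewrite braketZl -si Jy ?mulr0 //.
by apply: (fsubsetP iJ); apply/imfsetP; exists k.
Qed.

End Parseval.
End OrthonormalBasis.

(** * Traces, trace norm and fidelity *)

Section RankOne.
Variables (R : realType) (E : hilbert R).
Implicit Types (A S T M : E -> E) (psi phi x y : E).

Lemma bounded_opP T (C : R[i]) : linear T ->
  (forall x, `|T x| <= C * `|x|) -> bounded_op T.
Proof.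
move=> Tl TC; split=> //.
have C0 : 0 <= `|C| by [].
have TC' x : `|T x| <= `|C| * `|x|.
  (* [C] is an arbitrary complex number, but its product with the norm of [x] dominates a norm and
     so equals its own modulus. *)
  apply: (le_trans (TC x)); have := le_trans (normr_ge0 (T x)) (TC x).
  by move=> /ger0_norm <-; rewrite normrM normr_id.
pose lT := GRing.isLinear.Build _ _ _ _ T Tl.
pose T' : {linear E -> E} := HB.pack T lT.
apply: (@bounded_linear_continuous _ _ _ T'); apply/bounded_funP => r.
exists (`|C| * r) => x xr; apply: (le_trans (TC' x)).
by rewrite ler_wpM2l.
Qed.

Lemma ketbra_linear x y : linear (ketbra x y).
Proof.
by move=> a u v; rewrite /ketbra braketDr braketZr scalerDl scalerA.
Qed.

Lemma scaled_ketbra_bounded (c : R[i]) x y : bounded_op (c *: ketbra x y).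
Proof.
apply: (@bounded_opP _ (`|c| * (`|y| * `|x|))) => [a u v|z].
  rewrite !scalrfctE ketbra_linear scalerDr !scalerA.
  by rewrite [c * a]mulrC.
rewrite !scalrfctE /ketbra !normrZ -mulrA ler_wpM2l // [leRHS]mulrAC.
by rewrite ler_wpM2r // braket_cauchy_schwarz.
Qed.

Lemma ketbra_bounded x y : bounded_op (ketbra x y).
Proof. by rewrite -[ketbra x y]scale1r; exact: scaled_ketbra_bounded. Qed.

Lemma ketbra_positive psi : positive_op (ketbra psi psi).
Proof.
by move=> x; rewrite /ketbra braketZr -braketC -normCKC exprn_ge0.
Qed.

Lemma ketbra_idem psi : ⟨ psi | psi ⟩ = 1 ->
  ketbra psi psi \o ketbra psi psi = ketbra psi psi.
Proof.
by move=> p1; apply/funext => x; rewrite /ketbra /= braketZr p1 mulr1.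
Qed.

Lemma ketbra_trace (c : R[i]) psi : ⟨ psi | psi ⟩ = 1 ->
  has_trace (c *: ketbra psi psi) c.
Proof.
move=> p1 I e [e_on e_full].
have -> : partial_sum (fun i => ⟨ e i | (c *: ketbra psi psi) (e i) ⟩) =
    fun J => c *: (partial_sum (fun i => `|⟨ e i | psi ⟩| ^+ 2) J : R[i]^o).
  apply/funext => J; rewrite /partial_sum scaler_sumr; apply: eq_bigr => i _.
  rewrite scalrfctE /ketbra !braketZr normCK braketC; congr (c * _).
  exact: mulrC.
have := parseval e_on (x := psi) e_full.
rewrite -braket_normE p1 => cv.
rewrite -[X in _ --> X]mulr1.
exact: (@cvgZl_tmp _ R[i]^o).
Qed.

Lemma has_trace_unique T (t t' : R[i]) psi : ⟨ psi | psi ⟩ = 1 ->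
  has_trace T t -> has_trace T t' -> t = t'.
Proof.
move=> /orthonormal_basis_extension[I [e [_ [e_basis _]]]].
move=> /(_ I e e_basis) tt /(_ I e e_basis) tt'.
exact: (cvg_unique (@norm_hausdorff _ R[i]^o) tt tt').
Qed.

(** Extend [phi] to an orthonormal basis: the left side becomes one of the nonnegative terms whose
    sum is [t]. *)
Lemma has_trace_ge A (t : R) phi : positive_op A -> has_trace A t%:C ->
  ⟨ phi | phi ⟩ = 1 -> ⟨ phi | A phi ⟩ <= t%:C.
Proof.
move=> A0 At /orthonormal_basis_extension[I [e [i [e_basis <-]]]].
have := At I e e_basis.
move=> /(@cvgrPdist_le _ R[i]^o) tcv.
rewrite -(ge0_RRe (A0 _)) lecR; apply/ler_addgt0Pr => eps eps0.
have /tcv[J0 _ J0t] : 0 < eps%:C by rewrite ltcR.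
have := J0t (i |` J0)%fset (fsubsetU1 _ _); rewrite /=.
set s := partial_sum _ _ => ts.
have is_ : ⟨ e i | A (e i) ⟩ <= s.
  rewrite /s /partial_sum -(big_seq_fsetE _ _ xpredT
    (fun i => ⟨ e i | A (e i) ⟩)) /=.
  by rewrite (bigD1_seq i) ?fset_uniq ?fset1U1 //= lerDl sumr_ge0.
have s0 : 0 <= s by exact: le_trans (A0 _) is_.
rewrite -lecR rmorphD (ge0_RRe (A0 _)) (le_trans is_) // -lerBlDl.
apply: le_trans ts; rewrite distrC; apply: real_ler_norm.
by apply: rpredB; [exact: ger0_real|apply/complex_realP; exists t].
Qed.

(* |T psi| = |A psi| for A = |T|; the Cauchy-Schwarz inequality for the form
   ⟨ . | A . ⟩, applied to psi and to the unit vector along A psi, bounds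
   |A psi|^2 by a product of two diagonal values of A. *)
Lemma has_trace_norm_ge T (t : R) psi : has_trace_norm T t ->
  ⟨ psi | psi ⟩ = 1 -> `|⟨ psi | T psi ⟩| <= t%:C.
Proof.
move=> [S [A [[_ ST] [[Al _] A0 AA] At]]] p1.
have As := positive_op_sym Al A0.
have TA : `|T psi| = `|A psi|.
  apply/eqP; rewrite -(@eqrXn2 _ 2) //; apply/eqP.
  rewrite -!braket_normE -ST As.
  by rewrite -[S (T psi)]/((S \o T) psi) -AA.
have t0 : 0 <= t%:C by exact: le_trans (A0 psi) (has_trace_ge A0 At p1).
have psi1 : `|psi| = 1.
  apply/eqP; rewrite -(@eqrXn2 _ 2) //; apply/eqP.
  by rewrite -braket_normE p1 expr1n.
apply: (le_trans (braket_cauchy_schwarz _ _)); rewrite psi1 mul1r TA.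
have [->|Ap0] := eqVneq (A psi) 0; first by rewrite normr0.
pose phi := `|A psi|^-1 *: A psi.
have phi1 : ⟨ phi | phi ⟩ = 1 by exact: normalized_unit.
have phiA : `|⟨ phi | A psi ⟩| = `|A psi|.
  rewrite braketZl braket_normE geC0_conj ?invr_ge0 // expr2 mulKf ?normr_id //.
  by rewrite normr_eq0.
rewrite -(@ler_pXn2r _ 2) ?nnegrE //.
rewrite -phiA (le_trans (positive_op_cauchy_schwarz _ _ Al A0)) // expr2.
by rewrite ler_pM ?A0 ?(has_trace_ge A0 At).
Qed.

(** [trace_class] makes the set behind [xget] inhabited, so [trace_norm T] is a genuine trace norm
    and not the default 0. *)
Lemma trace_norm_ge T psi : trace_class T -> ⟨ psi | psi ⟩ = 1 ->
  `|⟨ psi | T psi ⟩| <= (trace_norm T)%:C.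
Proof. by move=> [_ /(xgetPex 0)]; exact: has_trace_norm_ge. Qed.

Lemma ketbra_trace_class psi : ⟨ psi | psi ⟩ = 1 ->
  trace_class (ketbra psi psi).
Proof.
move=> p1; split; first exact: ketbra_bounded.
exists 1, (ketbra psi psi), (ketbra psi psi); split.
- split=> [|x y]; first exact: ketbra_bounded.
  by rewrite /ketbra braketZl braketZr braketC mulrC.
- by split=> //; [exact: ketbra_bounded|exact: ketbra_positive].
- by rewrite -[ketbra _ _]scale1r; exact: ketbra_trace.
Qed.

Lemma is_sqrt_scaled_projector (c : R[i]) psi : ⟨ psi | psi ⟩ = 1 -> 0 <= c ->
  is_sqrt (c *: ketbra psi psi) (sqrtC c *: ketbra psi psi).
Proof.
move=> p1 c0; split; first exact: scaled_ketbra_bounded.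
  move=> x; rewrite scalrfctE braketZr mulr_ge0 ?sqrtC_ge0 //.
  exact: ketbra_positive.
apply/funext => x; rewrite /= !scalrfctE /ketbra braketZr braketZr p1 mulr1.
by rewrite !scalerA mulrA -expr2 sqrtCK.
Qed.

(* M vanishes on the orthogonal complement of psi, hence M z = ⟨psi|z⟩ M psi;
   as M is symmetric, psi is an eigenvector. *)
Lemma sqrt_scaled_projector_unique (c : R[i]) psi M : ⟨ psi | psi ⟩ = 1 ->
  is_sqrt (c *: ketbra psi psi) M -> M = sqrtC c *: ketbra psi psi.
Proof.
move=> p1 [[Ml _] M0 MM].
have Ms := positive_op_sym Ml M0.
have MMz z : M (M z) = c *: (⟨ psi | z ⟩ *: psi).
  by rewrite -[LHS]/((M \o M) z) MM.
have M_orth z : ⟨ psi | z ⟩ = 0 -> M z = 0.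
  move=> pz; apply: braket_eq0; rewrite Ms MMz pz scale0r scaler0.
  exact: braket0l.
have Mz z : M z = ⟨ psi | z ⟩ *: M psi.
  have : M (z - ⟨ psi | z ⟩ *: psi) = 0.
    by apply: M_orth; rewrite braketBr braketZr p1 mulr1 subrr.
  rewrite -scaleN1r (linear_opD Ml) !(linear_opZ Ml) scaleN1r => /eqP.
  by rewrite subr_eq0 => /eqP.
pose m := ⟨ psi | M psi ⟩.
have Mpsi : M psi = m *: psi.
  apply/eqP; rewrite -subr_eq0; apply/eqP/braket_eq0.
  set w := M psi - _.
  rewrite /w braketBl braketZl -Ms Mz braketZr -/m geC0_conj ?M0 //.
  by rewrite mulrC subrr.
have mc : m ^+ 2 = c.
  have := MMz psi; rewrite p1 scale1r Mpsi (linear_opZ Ml) Mpsi scalerA.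
  move=> /(congr1 (fun z => ⟨ psi | z ⟩)).
  by rewrite !braketZr p1 !mulr1 expr2.
apply/funext => z; rewrite Mz Mpsi -mc sqrCK ?M0 // scalrfctE /ketbra.
by rewrite !scalerA mulrC.
Qed.

(** As [fidelity] is chosen by [xget], a witness is exhibited and every other candidate is shown to
    agree with it. The root of [s] times the projector has trace [sqrtC s], and squaring returns
    [s]. *)
Lemma fidelity_pure psi (sigma : E -> E) : ⟨ psi | psi ⟩ = 1 ->
  linear sigma -> 0 <= ⟨ psi | sigma psi ⟩ ->
  fidelity (ketbra psi psi) sigma = complex.Re ⟨ psi | sigma psi ⟩.
Proof.
move=> p1 sl s0; set s := ⟨ psi | sigma psi ⟩.
have sqrt1 S : is_sqrt (ketbra psi psi) S -> S = ketbra psi psi.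
  rewrite -[ketbra psi psi]scale1r => /(sqrt_scaled_projector_unique p1) ->.
  by rewrite sqrtC1.
have PsP : ketbra psi psi \o sigma \o ketbra psi psi = s *: ketbra psi psi.
  apply/funext => z; rewrite /= scalrfctE /ketbra (linear_opZ sl) braketZr.
  by rewrite scalerA mulrC.
pose t := complex.Re (sqrtC s).
have tE : t%:C = sqrtC s by rewrite ge0_RRe ?sqrtC_ge0.
have t2 : t ^+ 2 = complex.Re s.
  by apply: complexI; rewrite rmorphXn /= tE sqrtCK ge0_RRe.
rewrite /fidelity; apply: xget_unique.
  exists (ketbra psi psi), (sqrtC s *: ketbra psi psi), t; split=> //.
  - split; [exact: ketbra_bounded|exact: ketbra_positive|exact: ketbra_idem].
  - by rewrite PsP; exact: is_sqrt_scaled_projector.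
  - by rewrite tE; exact: ketbra_trace.
move=> _ [S [M [t' [/sqrt1 -> + + ->]]]].
rewrite PsP => /(sqrt_scaled_projector_unique p1) -> Mt'.
rewrite -t2; congr (_ ^+ 2); apply: complexI; rewrite tE.
by apply: (has_trace_unique p1 Mt'); exact: ketbra_trace.
Qed.

(** Linearity is part of being trace class; positivity is complete positivity for one-by-one blocks.
    Both feed [fidelity_pure]. *)
Lemma channel_pure_output (Phi : (E -> E) -> E -> E) psi : is_channel Phi ->
  ⟨ psi | psi ⟩ = 1 -> linear (Phi (ketbra psi psi)) /\
    positive_op (Phi (ketbra psi psi)).
Proof.
move=> [Ptc _ Pcp _] p1; have Ptr := ketbra_trace_class p1.
split=> [|x]; first by case: (Ptc _ Ptr) => [[]].
have := Pcp 1%N (fun _ _ => ketbra psi psi) (fun _ _ => Ptr).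
have kp : positive_block (fun _ _ : 'I_1 => ketbra psi psi).
  by move=> y; rewrite !big_ord1; exact: ketbra_positive.
by move=> /(_ kp (fun=> x)); rewrite !big_ord1.
Qed.

End RankOne.

(** * Weak noise *)

Section WeakNoiseFidelity.
Variables (R : realType) (N : hilbert R) (n K : nat).
Variables (h : 'I_K -> unbounded_op N) (psi : N).
Hypothesis h_herm : forall j, hermitian_op (h j).
Hypothesis psi1 : ⟨ psi | psi ⟩ = 1.
Hypothesis h_dom : forall i, op_dom (h i) psi.
Hypothesis hh_dom : forall i j, op_dom (h i) (h j psi).

Local Notation trVH V :=
  (\tr (map_mx (real_complex R) V *m generator_matrix h psi)).

(** By Hermiticity on the given domains, both halves of the anticommutator have expectation ⟨psi |
    h_i h_j psi⟩, which absorbs the factor 1/2. *)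
Lemma noise_term_expectation i j :
  ⟨ psi | noise_term h psi i j psi ⟩ = - generator_matrix h psi i j.
Proof.
have sym k x y : op_dom (h k) x -> op_dom (h k) y ->
    ⟨ h k x | y ⟩ = ⟨ x | h k y ⟩.
  by move=> xk yk; have [_ ->] := h_herm k.
rewrite mxE /noise_term.
have -> : (ketbra (h i psi) (h j psi) - 2^-1 *: (ketbra (h i (h j psi)) psi +
    ketbra psi (h j (h i psi)))) psi = ⟨ h j psi | psi ⟩ *: h i psi -
  2^-1 *: (⟨ psi | psi ⟩ *: h i (h j psi) + ⟨ h j (h i psi) | psi ⟩ *: psi).
  by [].
rewrite braketBr !braketZr braketDr !braketZr psi1 !sym //.
by field.
Qed.

(** The trace pairs [V i j] with the entry [j i], the channel with the entry [i j]; symmetry of [V]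
    reconciles them. *)
Lemma trVH_sum (V : 'M[R]_K) : V^T = V ->
  trVH V = \sum_i \sum_j (V i j)%:C * generator_matrix h psi i j.
Proof.
move=> Vsym; rewrite exchange_big /mxtrace; apply: eq_bigr => j _.
rewrite mxE; apply: eq_bigr => i _; rewrite mxE; congr (_%:C * _).
by rewrite -{1}Vsym mxE.
Qed.

Lemma output_expectation (V : 'M[R]_K) (sigma Rem : N -> N) : V^T = V ->
  sigma = ketbra psi psi + \sum_i \sum_j (V i j)%:C *: noise_term h psi i j
    + Rem ->
  ⟨ psi | sigma psi ⟩ = 1 - trVH V + ⟨ psi | Rem psi ⟩.
Proof.
move=> Vsym ->.
have -> : (ketbra psi psi + \sum_i \sum_j (V i j)%:C *: noise_term h psi i j
    + Rem) psi = ⟨ psi | psi ⟩ *: psi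
      + \sum_i \sum_j (V i j)%:C *: noise_term h psi i j psi + Rem psi.
  rewrite !fctE fct_sumE; congr (_ + _ + _); apply: eq_bigr => i _.
  by rewrite fct_sumE.
rewrite psi1 scale1r !braketDr psi1 braket_sumr (trVH_sum Vsym) -sumrN.
congr (_ + _ + _); apply: eq_bigr => i _; rewrite braket_sumr -sumrN.
by apply: eq_bigr => j _; rewrite braketZr noise_term_expectation mulrN.
Qed.

(* With q = sqrt (1 - w) the difference is 4 (1 - q)^2, and |1 - q| <= |w|. *)
Lemma sqrt_linearization (w : R) : w <= 1 ->
  `|8 * (1 - Num.sqrt (1 - w)) - 4 * w| <= 4 * w ^+ 2.
Proof.
rewrite -subr_ge0 => w1; set q := Num.sqrt _.
have q0 : 0 <= q by exact: sqrtr_ge0.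
have q2 : w = 1 - q ^+ 2 by rewrite sqr_sqrtr // subKr.
have -> : 8 * (1 - q) - 4 * w = 4 * (1 - q) ^+ 2 by rewrite q2; ring.
have d0 : 0 <= 4 * (1 - q) ^+ 2 by apply: mulr_ge0 => //; exact: sqr_ge0.
rewrite (ger0_norm d0); apply: ler_wpM2l => //.
have -> : w ^+ 2 = (1 - q) ^+ 2 * (1 + q) ^+ 2 by rewrite q2; ring.
by rewrite ler_peMr ?sqr_ge0 // exprn_ege1 // lerDl.
Qed.

(** Write the overlap of [psi] with the output as [1 - w]. Replacing the fidelity expression by
    [4 * w] costs the first error term, by [sqrt_linearization]; replacing [w] by the trace costs
    the second. *)
Lemma fidelity_expansion (V : 'M[R]_K) (Phi : (N -> N) -> N -> N)
    (Rem : N -> N) (r := trace_norm Rem) :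
  V^T = V -> is_channel Phi -> trace_class Rem ->
  Phi (ketbra psi psi) = ketbra psi psi
    + \sum_i \sum_j (V i j)%:C *: noise_term h psi i j + Rem ->
  `|(8 * (1 - Num.sqrt (fidelity (ketbra psi psi) (Phi (ketbra psi psi)))))%:C
    - 4 * trVH V| <= 4 * (`|trVH V| + r%:C) ^+ 2 + 4 * r%:C.
Proof.
move=> Vsym Pch Rtc Pexp.
have [sl s0] := channel_pure_output Pch psi1.
have Rr : `|⟨ psi | Rem psi ⟩| <= r%:C by exact: trace_norm_ge.
have := s0 psi; rewrite (fidelity_pure psi1 sl (s0 psi)).
rewrite (output_expectation Vsym Pexp).
set X := trVH V; set rho := ⟨ psi | Rem psi ⟩ in Rr *; set s := 1 - X + rho.
(* [X] and [rho] are complex numbers, but positivity of the output makes [s] real and nonnegative,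
   so [w] is real and at most 1. *)
move=> {}s0; pose w := 1 - complex.Re s.
have wE : w%:C = X - rho.
  by rewrite rmorphB rmorph1 /= ge0_RRe // /s opprD opprB addrA subrKC.
have -> : complex.Re s = 1 - w by rewrite subKr.
have w1 : w <= 1 by rewrite gerBl -lecR ge0_RRe.
set q := 8 * _.
have -> : q%:C - 4 * X = (q - 4 * w)%:C - 4 * rho.
  have -> : (q - 4 * w)%:C = q%:C - 4 * w%:C.
    by rewrite rmorphB; congr (_ - _); rewrite rmorphM rmorph_nat.
  by rewrite wE; ring.
apply: (le_trans (ler_normB _ _)); apply: lerD; last first.
  by rewrite normrM normr_nat ler_wpM2l.
rewrite normc_real; apply: (@le_trans _ _ (4 * w ^+ 2)%:C).
  by rewrite lecR; exact: sqrt_linearization.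
rewrite rmorphM rmorph_nat ler_wpM2l //.
rewrite -real_normK ?num_real // rmorphXn /= -normc_real wE.
apply: lerXn2r; rewrite ?nnegrE ?addr_ge0 ?(le_trans _ Rr) //.
by apply: (le_trans (ler_normB _ _)); rewrite lerD2l.
Qed.

Lemma normr_mx_coef m p (A : 'M[R]_(m, p)) i j : `|A i j| <= `|A|.
Proof.
rewrite [leRHS]mx_normrE.
exact: (le_bigmax _ (fun ij : 'I_m * 'I_p => `|A ij.1 ij.2|) (i, j)).
Qed.

Lemma trVH_le (V : 'M[R]_K) :
  `|trVH V| <= `|V|%:C * \sum_i \sum_j `|generator_matrix h psi j i|.
Proof.
rewrite /mxtrace mulr_sumr (le_trans (ler_norm_sum _ _ _)) // ler_sum // => i _.
rewrite mxE mulr_sumr (le_trans (ler_norm_sum _ _ _)) // ler_sum // => j _.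
rewrite normrM mxE ler_wpM2r //.
by rewrite normc_real lecR normr_mx_coef.
Qed.

(** Of the two errors in [fidelity_expansion], the squared one is of fourth order and the other is
    o(|Theta|^2); each is made at most half of the allowed [e * tau]. *)
Lemma fidelity_second_order (V : 'rV[R]_n -> 'M[R]_K)
    (Phi : 'rV[R]_n -> (N -> N) -> N -> N) :
  covariance_family V -> weak_noise_channel h psi V Phi ->
  eq_second_order
    (fun Th => (8 * (1 - Num.sqrt
       (fidelity (ketbra psi psi) (Phi Th (ketbra psi psi)))))%:C)
    (fun Th => 4 * trVH (V Th)).
Proof.
move=> [Vcov VO] [Pch [Rem [Pexp Rtc Ro]]].
move/eqO_exP: VO => [k k0 VO].
pose b := complex.Re (\sum_i \sum_j `|generator_matrix h psi j i|).
have bE : b%:C = \sum_i \sum_j `|generator_matrix h psi j i|.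
  by rewrite ge0_RRe // sumr_ge0 // => i _; rewrite sumr_ge0.
have b0 : 0 <= b.
  by rewrite -lecR bE sumr_ge0 // => i _; rewrite sumr_ge0.
(* In units of |Theta|^2, [k * b] bounds the trace of [V] times the generator matrix and 1 bounds
   the trace norm of the remainder. *)
pose B := k * b + 1.
have B1 : 1 <= B by rewrite lerDr mulr_ge0 ?(ltW k0).
have B0 : 0 < B by exact: lt_le_trans B1.
apply/eqoP => eps eps0.
pose e := complex.Re eps.
have eE : e%:C = eps by rewrite ge0_RRe ?(ltW eps0).
have e0 : 0 < e by rewrite -ltcR eE.
(* The 1 gives [r <= tau]; [e / 8] gives [4 * (c * tau) <= e / 2 * tau]. *)
pose c := Num.min 1 (e / 8).
have c0 : 0 < c by rewrite lt_min ltr01 divr_gt0.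
move/eqoP: Ro => /(_ c c0) Ro.
(* The 1 bounds [tau] by the norm of [Th]; the other entry then gives
   [4 * (B * tau) ^+ 2 <= e / 2 * tau]. *)
pose d := Num.min 1 (e / (8 * B ^+ 2)).
have d0 : 0 < d by rewrite lt_min ltr01 divr_gt0 ?mulr_gt0 ?exprn_gt0.
have Thd : \forall Th \near (0 : 'rV[R]_n), `|Th| < d.
  by apply/nbhs_norm0P; exists d.
near=> Th.
have tau_norm : `|(`|Th| ^+ 2 : R^o)| = `|Th| ^+ 2.
  by rewrite ger0_norm ?exprn_ge0.
have VTh : `|V Th| <= k * `|Th| ^+ 2.
  by rewrite -tau_norm; near: Th; exact: VO.
have : `|trace_norm (Rem Th) : R^o| <= c * `|(`|Th| ^+ 2 : R^o)|.
  by near: Th; exact: Ro.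
rewrite tau_norm => /(le_trans (ler_norm _)) rc.
have Th_d : `|Th| < d by near: Th; exact: Thd.
have := @fidelity_expansion (V Th) (Phi Th) (Rem Th).
set r := trace_norm _ in rc *; set X := trVH _.
set f := (8 * _)%:C.
have -> : `|(`|Th| ^+ 2)%:C : R[i]^o| = (`|Th| ^+ 2)%:C.
  by rewrite ger0_norm // lecR exprn_ge0.
set tau := `|Th| ^+ 2 in VTh rc *.
move=> H; apply: (le_trans (H _ _ _ _)).
- by near: Th; apply: filterS Vcov => Th' [].
- by near: Th.
- by near: Th.
- by near: Th.
have tau0 : 0 <= tau by rewrite exprn_ge0.
have XB : `|X| + r%:C <= (B * tau)%:C.
  rewrite mulrDl mul1r rmorphD; apply: lerD; last first.
    by rewrite lecR (le_trans rc) // ler_piMl // ge_min lexx.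
  apply: (le_trans (trVH_le _)); rewrite -bE -rmorphM /= lecR mulrAC.
  by rewrite ler_wpM2r.
have r0 : 0 <= r%:C.
  apply: le_trans (trace_norm_ge _ psi1); first by [].
  by near: Th.
apply: (@le_trans _ _ (4 * (B * tau) ^+ 2 + 4 * (c * tau))%:C).
  have -> : (4 * (B * tau) ^+ 2 + 4 * (c * tau))%:C =
      4 * (B * tau)%:C ^+ 2 + 4 * (c * tau)%:C.
    rewrite rmorphD; congr (_ + _); rewrite rmorphM rmorph_nat //.
    by rewrite rmorphXn.
  apply: lerD; apply: ler_wpM2l => //; last by rewrite lecR.
  by apply: lerXn2r; rewrite ?nnegrE ?addr_ge0 // lecR mulr_ge0 ?(ltW B0).
rewrite -eE -rmorphM /= lecR.
have taud : tau <= e / (8 * B ^+ 2).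
  have Th1 : `|Th| <= 1 by rewrite ltW // (lt_le_trans Th_d) // ge_min lexx.
  apply: (@le_trans _ _ `|Th|); first by rewrite /tau expr2 ler_piMl.
  by rewrite ltW // (lt_le_trans Th_d) // ge_min lexx orbT.
have c8 : c <= e / 8 by rewrite ge_min lexx orbT.
have h1 : 4 * (c * tau) <= e / 2 * tau.
  by rewrite mulrA ler_wpM2r //; move: c8; lra.
have h2 : 4 * (B * tau) ^+ 2 <= e / 2 * tau.
  have -> : 4 * (B * tau) ^+ 2 = (4 * B ^+ 2 * tau) * tau by ring.
  rewrite ler_wpM2r //; move: taud; rewrite ler_pdivlMr ?mulr_gt0 ?exprn_gt0 //.
  by lra.
by rewrite (le_trans (lerD h2 h1)) // -mulrDl -splitr.
Unshelve. all: by end_near. Qed.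

End WeakNoiseFidelity.

(** Both hypotheses share the first function, which is the fidelity expression in the application,
    and [g - k = (f - k) - (f - g)]. *)
Lemma eq_second_order_trans (R : realType) (n : nat)
    (f g k : 'rV[R]_n -> R[i]) :
  eq_second_order f g -> eq_second_order f k -> eq_second_order g k.
Proof.
move=> /eqoP fg /eqoP fk; apply/eqoP => eps eps0.
have e2 : 0 < eps / 2 by rewrite divr_gt0.
near=> Th.
have -> : g Th - k Th = (f Th - k Th) - (f Th - g Th).
  by rewrite opprB [RHS]addrC addrA subrK.
rewrite (le_trans (ler_normB _ _)) // (splitr eps) mulrDl lerD //.
  by near: Th; exact: fk.
by near: Th; exact: fg.
Unshelve. all: by end_near. Qed.

Theorem mainTheorem1 (R : realType) (H N : hilbert R) (K n : nat)
    (tens : ('I_K -> H) -> N) (h : 'I_K -> unbounded_op N) (psi : N)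
    (V : 'rV[R]_n -> 'M[R]_K)
    (Phi : 'rV[R]_n -> (N -> N) -> N -> N)
    (F : 'rV[R]_n -> 'M[R]_n) :
  is_tensor_power tens ->
  (forall j, hermitian_op (h j)) ->
  (forall j, acts_on_sensor tens j (h j)) ->
  ⟨ psi | psi ⟩ = 1 ->
  (forall i, op_dom (h i) psi) ->
  (forall i j, op_dom (h i) (h j psi)) ->
  covariance_family V ->
  weak_noise_channel h psi V Phi ->
  is_qfi_matrix (ketbra psi psi)
    (fun Theta => Phi Theta (ketbra psi psi)) F ->
  eq_second_order
    (fun Theta => (quad_form (F Theta) Theta)%:C)
    (fun Theta =>
       4 * \tr (map_mx (real_complex R) (V Theta) *m generator_matrix h psi)).
Proof.
move=> _ h_herm _ psi1 h_dom hh_dom Vcov noisy [_ qfi].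
exact: eq_second_order_trans qfi
  (fidelity_second_order h_herm psi1 h_dom hh_dom Vcov noisy).
Qed.
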